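(* Consider a single-product inventory problem without dynamics, that is, with scalar states, controls and parameters, transitions $f_t\equiv 0$ for all $t$, and arbitrary losses $\ell_t$. Suppose the algorithm GAPSI (described in the context) is run on it with the base-stock policy $\pi_t(x,\theta)=[\theta-x]^+$, and suppose that the derivatives of the policy used by the algorithm are computed either by auto-differentiation with the convention $\mathrm{ReLU}'(0)=0$, or as left partial derivatives. Then, if the base-stock level reaches zero, it remains zero for all subsequent periods: if $\theta_t=0$ for some $t\in\mathbb{N}$, then $\theta_s=0$ for all $s\geq t$.
   Context: Notation: $[y]^+=\max\{y,0\}$, $\mathbb{N}=\{1,2,\dots\}$, $\mathbb{R}_+=[0,\infty)$, and $\mathrm{ReLU}(y)=[y]^+$. Online setting (scalar case). At each period $t=1,2,\dots$ the manager observes the state $x_t\in\mathbb{R}_+$ (with $x_1=0$), orders $u_t=\pi_t(x_t,\theta_t)$, incurs the loss $\ell_t(x_t,u_t)\in\mathbb{R}$, and the next state is $x_{t+1}=f_t(x_t,u_t)$. The parameter $\theta_t$ lies in an interval $\Theta=[a,b]\subset\mathbb{R}_+$ with $a<b$; for the base-stock policy $\pi_t(x,\theta)=[\theta-x]^+$ the number $\theta_t$ is called the base-stock level at time $t$. GAPSI (scalar case). Parameters: a learning rate factor $\eta>0$, a buffer size $B\in\mathbb{N}$, an initial $\theta_1\in\Theta$. At each period $t$ the algorithm computes real numbers, denoted below by partial derivative symbols, serving as (generalized) partial derivatives of $\ell_t$ and $f_t$ at $(x_t,u_t)$ and of $\pi_t$ at $(x_t,\theta_t)$. The values for $\ell_t$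 are arbitrary; those for $f_t\equiv0$ are $\frac{\partial f_t}{\partial x_t}=\frac{\partial f_t}{\partial u_t}=0$. For the policy, $\frac{\partial\pi_t}{\partial\theta_t}=\mathrm{ReLU}'(\theta_t-x_t)$ and $\frac{\partial\pi_t}{\partial x_t}=-\mathrm{ReLU}'(\theta_t-x_t)$ with $\mathrm{ReLU}'(y)=1$ for $y>0$ and $\mathrm{ReLU}'(y)=0$ for $y\le0$ in the auto-differentiation case; in the left-derivative case they are the left partial derivatives of $(x,\theta)\mapsto[\theta-x]^+$ at $(x_t,\theta_t)$, where the left derivative of a function $h$ at $y$ is $\lim_{\varepsilon\to0^-}(h(y+\varepsilon)-h(y))/\varepsilon$. The approximated gradient is $$g_t=\frac{\partial \ell_t}{\partial u_t}\frac{\partial \pi_t}{\partial \theta_t}+\Big(\frac{\partial \ell_t}{\partial x_t}+\frac{\partial \ell_t}{\partial u_t}\frac{\partial \pi_t}{\partial x_t}\Big)\sum_{b'=1}^{B-1}\frac{\partial x_t}{\partial\theta_{t-b'}},$$ where terms with $t-b'<1$ are omitted, $\frac{\partial x_t}{\partial\theta_{t-1}}=\frac{\partial f_{t-1}}{\partial u_{t-1}}\frac{\partial\pi_{t-1}}{\partial\theta_{t-1}}$, and for $b'\ge2$, $\frac{\partial x_t}{\partial\theta_{t-b'}}=\Big(\frac{\partial f_{t-1}}{\partial x_{t-1}}+\frac{\partial f_{t-1}}{\partial u_{t-1}}\frac{\partial\pi_{t-1}}{\partial x_{t-1}}\Big)\frac{\partial x_{t-1}}{\partial\theta_{t-b'}}$.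 The parameter update is $\theta_{t+1}=\mathrm{Proj}_\Theta(\theta_t-H_tg_t)$, where $\mathrm{Proj}_\Theta$ is the Euclidean projection onto $\Theta$ and $H_t=\eta\,(b-a)\big/\sqrt{\sum_{s=1}^t g_s^2}$, with the convention $H_tg_t=0$ whenever $g_t=0$ (including when all gradients so far vanish). *)

(* Defs.v *)
From mathcomp Require Import all_boot all_order all_algebra.
From mathcomp Require Import all_classical all_reals all_analysis.
Import Order.TTheory GRing.Theory Num.Theory.
Import numFieldNormedType.Exports.

Set Implicit Arguments.
Unset Strict Implicit.
Unset Printing Implicit Defensive.

Local Open Scope classical_set_scope.
Local Open Scope ring_scope.

(* Periods are numbered 1, 2, 3, ...; the value at index 0 of a sequence
   indexed by periods is never constrained nor used. *)

Definition relu {R : realType} (y : R) : R := Num.max y 0.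

(* The derivative of relu used by auto-differentiation, with relu'(0) = 0. *)
Definition relu_ad {R : realType} (y : R) : R := if 0 < y then 1 else 0.

Definition base_stock {R : realType} (x th : R) : R := relu (th - x).

Definition is_left_derivative {R : realType} (h : R -> R) (y d : R) : Prop :=
  (h (y + e) - h y) / e @[e --> 0^'-] --> d.

Definition is_projection {R : realType} (A : set R) (y p : R) : Prop :=
  A p /\ forall q, A q -> `|y - p| <= `|y - q|.

(* Losses l_t(x, u), transitions f_t(x, u) and policies pi_t(x, theta); only
   their values at states x >= 0 are meaningful. *)
Record problem (R : realType) := Problem {
  loss : nat -> R -> R -> R;
  transition : nat -> R -> R -> R;
  policy : nat -> R -> R -> R }.

Record trajectory (R : realType) := Trajectory {
  state : nat -> R;
  control : nat -> R;
  param : nat -> R;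
  incurred : nat -> R }.

(* The numbers computed by the algorithm at period t in place of the partial
   derivatives of l_t and f_t at (x_t, u_t) and of pi_t at (x_t, theta_t).
   A priori they are unrelated to the functions themselves. *)
Record partials (R : realType) := Partials {
  dloss_x : nat -> R;
  dloss_u : nat -> R;
  dtrans_x : nat -> R;
  dtrans_u : nat -> R;
  dpol_x : nat -> R;
  dpol_th : nat -> R }.

Section Gapsi.
Context {R : realType}.
Implicit Types (P : problem R) (T : trajectory R) (D : partials R).

(* [state_sens D t k] is the derivative of x_t with respect to theta_{t-k},
   meaningful for 1 <= k < t. *)
Fixpoint state_sens D (t k : nat) : R :=
  match k with
  | 0 => 0
  | 1 => dtrans_u D t.-1 * dpol_th D t.-1
  | k'.+1 => (dtrans_x D t.-1 + dtrans_u D t.-1 * dpol_x D t.-1)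
             * state_sens D t.-1 k'
  end.

(* The condition k < t omits the terms with t - k < 1. *)
Definition gradient D (B t : nat) : R :=
  dloss_u D t * dpol_th D t
  + (dloss_x D t + dloss_u D t * dpol_x D t)
    * \sum_(1 <= k < B | (k < t)%N) state_sens D t k.

(* As 0^-1 = 0 in MathComp, this is 0 when all gradients up to t vanish; in any
   case the step [learning_rate * gradient] is 0 whenever the gradient is. *)
Definition learning_rate (a b eta : R) D (B t : nat) : R :=
  eta * (b - a) / Num.sqrt (\sum_(1 <= s < t.+1) gradient D B s ^+ 2).

Record gapsi_run (a b eta : R) (B : nat) P D T : Prop := GapsiRun {
  run_state1 : state T 1 = 0;
  run_param1 : `[a, b]%classic (param T 1);
  run_control : forall t, (0 < t)%N ->
    control T t = policy P t (state T t) (param T t);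
  run_incurred : forall t, (0 < t)%N ->
    incurred T t = loss P t (state T t) (control T t);
  run_state : forall t, (0 < t)%N ->
    state T t.+1 = transition P t (state T t) (control T t);
  run_param : forall t, (0 < t)%N ->
    is_projection `[a, b]%classic
      (param T t - learning_rate a b eta D B t * gradient D B t)
      (param T t.+1) }.

Definition autodiff_base_stock D T : Prop := forall t, (0 < t)%N ->
  dpol_th D t = relu_ad (param T t - state T t) /\
  dpol_x D t = - relu_ad (param T t - state T t).

Definition left_diff_base_stock D T : Prop := forall t, (0 < t)%N ->
  is_left_derivative (fun th => base_stock (state T t) th)
    (param T t) (dpol_th D t) /\
  is_left_derivative (fun x => base_stock x (param T t))
    (state T t) (dpol_x D t).

End Gapsi.

(* Main.v *)
Require Import Defs.
From mathcomp Require Import all_boot all_order all_algebra.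
From mathcomp Require Import all_classical all_reals all_analysis.
Import Order.TTheory GRing.Theory Num.Theory.
Import numFieldNormedType.Exports.
Local Open Scope classical_set_scope.
Local Open Scope ring_scope.

(** With zero transitions the state is always zero, so the policy derivative
    with respect to the base-stock level is the derivative of ReLU at the level
    itself. At level zero the kink is hit exactly, and both conventions assign
    it the value zero: auto-differentiation by decree
    ([autodiff_dpol_th_eq0]), left differentiation because ReLU is flat to the
    left of its kink ([left_diff_dpol_th_eq0]). The first term of the gradient
    therefore vanishes; the second one always does, as the zero transition
    derivatives kill the dependence of the state on past levels
    ([gradient_no_dynamics]). The projection step then starts from zero, a point
    of the parameter interval because it was the current level, and stays
    there. *)

Lemma is_left_derivative_unique {R : realType} (h : R -> R) (y d d' : R) :
  is_left_derivative h y d -> is_left_derivative h y d' -> d = d'.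
Proof. by move=> hd hd'; apply: (cvg_unique _ hd hd'). Qed.

(** To the left of its kink ReLU is constant, so the difference quotients there
    are all zero. *)
Lemma is_left_derivative_relu0 {R : realType} :
  is_left_derivative (@relu R) 0 0.
Proof.
rewrite /is_left_derivative; apply/cvgrPdist_lt => e e0.
near=> x.
have x0 : x < 0 by near: x; exact: nbhs_left_lt.
by rewrite !add0r /relu maxxx max_r ?(ltW x0) // subrr mul0r oppr0 normr0.
Unshelve. all: by end_near. Qed.

Lemma is_projection_id {R : realType} {A : set R} {y p : R} :
  A y -> is_projection A y p -> p = y.
Proof.
move=> Ay [_ /(_ y Ay)].
by rewrite subrr normr0 normr_le0 subr_eq0 => /eqP ->.
Qed.

Section NoDynamics.
Context {R : realType}.
Implicit Types (P : problem R) (T : trajectory R) (D : partials R).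

Lemma param_in_interval (a b eta : R) B P D T :
  gapsi_run a b eta B P D T ->
  forall t, (0 < t)%N -> `[a, b]%classic (param T t).
Proof.
move=> run [//|[|t]] _; first exact: run_param1 run.
by have [] := run_param run (ltn0Sn t).
Qed.

Lemma state_no_dynamics (a b eta : R) B P D T :
  (forall t (x u : R), (0 < t)%N -> 0 <= x -> transition P t x u = 0) ->
  gapsi_run a b eta B P D T -> forall t, (0 < t)%N -> state T t = 0.
Proof.
move=> trans0 run; elim=> [//|[_ _|t IH _]]; first exact: run_state1 run.
by rewrite (run_state run) // trans0 // IH.
Qed.

(** Every sensitivity carries a factor that is a derivative of the transition
    of the preceding period. *)
Lemma state_sens_no_dynamics D t k :
  (forall t, (0 < t)%N -> dtrans_x D t = 0 /\ dtrans_u D t = 0) ->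
  (k < t)%N -> state_sens D t k = 0.
Proof.
case: k => [//|k] dtrans0 ltkt.
(* Since [k.+1 < t], the recurrence reads the derivatives at the genuine
   period [t.-1 >= 1], never at the unconstrained index 0. *)
have /dtrans0[fx fu] : (0 < t.-1)%N by case: t ltkt => [|[]].
by case: k ltkt => [|k] _ /=; rewrite fu ?fx !mul0r // addr0 mul0r.
Qed.

Lemma gradient_no_dynamics D B t :
  (forall t, (0 < t)%N -> dtrans_x D t = 0 /\ dtrans_u D t = 0) ->
  gradient D B t = dloss_u D t * dpol_th D t.
Proof.
move=> dtrans0; rewrite /gradient big1 ?mulr0 ?addr0 // => k.
exact: state_sens_no_dynamics.
Qed.

Lemma autodiff_dpol_th_eq0 D T t :
  autodiff_base_stock D T -> (0 < t)%N -> param T t = state T t ->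
  dpol_th D t = 0.
Proof. by move=> ad /ad[-> _] ->; rewrite subrr /relu_ad ltxx. Qed.

(** At state zero the policy, as a function of the level, is ReLU itself, so the
    value is forced by uniqueness of limits. *)
Lemma left_diff_dpol_th_eq0 D T t :
  left_diff_base_stock D T -> (0 < t)%N -> state T t = 0 -> param T t = 0 ->
  dpol_th D t = 0.
Proof.
move=> ld /ld[+ _] x0 th0; rewrite x0 th0 => hd.
apply: is_left_derivative_unique hd _.
rewrite (_ : (fun th => _) = relu); first exact: is_left_derivative_relu0.
by apply/funext => th; rewrite /base_stock subr0.
Qed.

End NoDynamics.

Theorem propositionB1 (R : realType) (a b eta : R) (B : nat)
    (P : problem R) (D : partials R) (T : trajectory R)
    (a_ge0 : 0 <= a) (ltab : a < b) (eta_gt0 : 0 < eta) (B_gt0 : (0 < B)%N)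
    (trans0 : forall t (x u : R), (0 < t)%N -> 0 <= x -> transition P t x u = 0)
    (dtrans0 : forall t, (0 < t)%N -> dtrans_x D t = 0 /\ dtrans_u D t = 0)
    (pol : forall t (x th : R), (0 < t)%N -> 0 <= x ->
      policy P t x th = base_stock x th)
    (run : gapsi_run a b eta B P D T)
    (diff : autodiff_base_stock D T \/ left_diff_base_stock D T) :
  forall t, (0 < t)%N -> param T t = 0 ->
  forall s, (t <= s)%N -> param T s = 0.
Proof.
have step t : (0 < t)%N -> param T t = 0 -> param T t.+1 = 0.
  move=> t0 th0.
  have x0 := state_no_dynamics _ _ _ _ _ _ _ trans0 run t t0.
  have dpol0 : dpol_th D t = 0.
    case: diff => [ad|ld]; last exact: left_diff_dpol_th_eq0 ld t0 x0 th0.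
    by apply: autodiff_dpol_th_eq0 ad t0 _; rewrite th0 x0.
  have := run_param run t0.
  rewrite gradient_no_dynamics // dpol0 !mulr0 subr0 th0.
  apply: is_projection_id.
  by rewrite -th0; exact: param_in_interval run _ t0.
move=> t t0 th0 s /subnK <-.
elim: (s - t)%N => [//|k IH]; rewrite addSn.
by apply: step; rewrite // addn_gt0 t0 orbT.
Qed.
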